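(* Let $p\ge1$ be an integer and $g:\{1,\dots,2^p-1\}\to\mathbb{C}$ arbitrary. Let $f:\{1,\dots,2^p-1\}\to\mathbb{C}$ be the solution of the system \[ g(n)=\begin{cases} f(n)-f(2n)-f(2n+1), & 1\le n\le 2^{p-1}-1,\\ f(n), & 2^{p-1}\le n\le 2^p-1.\end{cases} \] Then for every $1\le n\le 2^p-1$, \[ f(n)=\sum_{k=0}^{p-l_{n}}\sum_{l=0}^{2^{k}-1}g\left(2^{k}n+l\right), \] where $l_n=\lfloor\log_2 n\rfloor+1$ is the number of bits in the binary representation of $n$. As a consequence, \[ \sum_{n=1}^{2^{p}-1}s_{2}(n)g(n)=\sum_{n=0}^{2^{p-1}-1}\sum_{k=0}^{p-l_{2n+1}}\sum_{l=0}^{2^{k}-1}g\left(2^{k+1}n+2^{k}+l\right). \]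
   Context: $s_2(n)$ is the number of ones in the binary expansion of $n$. *)

(* Defs.v *)
From HB Require Import structures.
From mathcomp Require Import all_boot all_order all_algebra.
From mathcomp Require Import reals complex.

Set Implicit Arguments.
Unset Strict Implicit.
Unset Printing Implicit Defensive.

Import Order.TTheory GRing.Theory Num.Theory.
Local Open Scope ring_scope.

Definition bitlen (n : nat) : nat := (trunc_log 2 n).+1.

(* [odd (n %/ 2 ^ i)] is the binary digit of weight [2 ^ i]. *)
Definition s2 (n : nat) : nat := (\sum_(i < bitlen n) odd (n %/ 2 ^ i))%N.

(* Functions on {1, ..., 2^p - 1} are represented by total functions on [nat];
   the system involves no value at an index outside that range. *)
Definition solves (C : zmodType) (p : nat) (g f : nat -> C) : Prop :=
  forall n : nat, (1 <= n <= 2 ^ p - 1)%N ->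
    g n = if (n <= 2 ^ p.-1 - 1)%N then f n - f (2 * n)%N - f (2 * n + 1)%N
          else f n.

(* Main.v *)
(* Unfolding f(n) = g(n) + f(2n) + f(2n+1) down the binary tree rooted at n
   gives the closed form: the descendants of n at depth k are the 2^k n + l with
   l < 2^k.  Substituting the system into the sum of s2(n) g(n), the coefficient
   of f(m) becomes s2(m) - s2(m %/ 2), the parity of m, so only the values of f
   at odd indices remain. *)
Require Import Defs.
From HB Require Import structures.
From mathcomp Require Import all_boot all_order all_algebra.
From mathcomp Require Import reals complex.
From mathcomp Require Import zify.

Import Order.TTheory GRing.Theory Num.Theory.
Local Open Scope ring_scope.

Lemma bitlen_leq (m n : nat) : (0 < n)%N -> (bitlen n <= m)%N = (n < 2 ^ m)%N.
Proof.
move=> n0; rewrite /bitlen; apply/idP/idP => [le|lt].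
  by apply: leq_trans (trunc_log_ltn n (isT : 1 < 2)%N) _; rewrite leq_exp2l.
by rewrite -(ltn_exp2l _ _ (isT : 1 < 2)%N) (leq_ltn_trans _ lt) ?trunc_logP.
Qed.

Lemma bitlen_double_add (b : bool) (n : nat) : (0 < n)%N ->
  bitlen (2 * n + b) = (bitlen n).+1.
Proof.
move=> n0.
have pos : (0 < 2 * n + b)%N by lia.
have E m : (bitlen (2 * n + b) <= m.+1)%N = (bitlen n <= m)%N.
  by rewrite !bitlen_leq // expnS; case: b pos; lia.
(* By [E] both sides have the same upper bounds up to the shift; these two instances give the two
   inequalities. *)
have := E (bitlen n); have := E (bitlen (2 * n + b)).-1.
by rewrite /bitlen; lia.
Qed.

Lemma s2_double_add (b : bool) (n : nat) : s2 (2 * n + b) = (s2 n + b)%N.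
Proof.
(* Zero is apart: [bitlen 0] and [bitlen 1] are both 1, so appending a bit does not lengthen it. *)
case: n => [|n]; first by case: b; rewrite /s2 /bitlen !big_ord_recl !big_ord0.
rewrite /s2 bitlen_double_add // big_ord_recl expn0 divn1 addnC.
congr (_ + _)%N; last by case: b; lia.
apply: eq_bigr => i _; rewrite /= /bump add1n expnS divnMA.
by congr (nat_of_bool (odd (_ %/ _))); case: b; lia.
Qed.

Lemma sum_double (V : nmodType) (F : nat -> V) (m : nat) :
  \sum_(0 <= n < 2 * m) F n = \sum_(0 <= n < m) (F (2 * n)%N + F (2 * n + 1)%N).
Proof.
elim: m => [|m IH]; first by rewrite !big_geq.
by rewrite mulnS !big_nat_recr //= IH addn1 addrA.
Qed.

Section ClosedForm.

Variables (V : zmodType) (g : nat -> V).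

(** The depth [d] is kept independent of [n] so that recursion can run on it. *)
Definition descendant_sum (d n : nat) : V :=
  \sum_(0 <= k < d.+1) \sum_(0 <= l < 2 ^ k) g (2 ^ k * n + l)%N.

Lemma descendant_sum0 (n : nat) : descendant_sum 0 n = g n.
Proof. by rewrite /descendant_sum !big_nat1 mul1n addn0. Qed.

(** Level [k.+1] below [n], cut at [l = 2 ^ k], is level [k] below [2 * n] followed by level [k]
    below [2 * n + 1]. *)
Lemma descendant_sumS (d n : nat) :
  descendant_sum d.+1 n =
    g n + descendant_sum d (2 * n) + descendant_sum d (2 * n + 1).
Proof.
rewrite /descendant_sum big_nat_recl // big_nat1 mul1n addn0 -addrA.
congr (_ + _); rewrite -big_split /=; apply: eq_bigr => k _.
rewrite (@big_cat_nat _ _ _ (2 ^ k)%N) ?leq_exp2l //=.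
congr (_ + _); first by apply: eq_bigr => l _; rewrite expnSr mulnA.
rewrite -{1}[(2 ^ k)%N]add0n big_addn expnS mul2n -addnn addnK.
by apply: eq_bigr => l _; congr g; lia.
Qed.

Lemma solves_descendant_sum (p : nat) : (0 < p)%N ->
  solves p g (fun n => descendant_sum (p - bitlen n) n).
Proof.
case: p => // p _ n /andP[n0 nlt] /=.
have [lt|ge] := ltnP n (2 ^ p).
  rewrite ifT; last by lia.
  have := bitlen_double_add false n n0; rewrite addn0 => ->.
  rewrite (bitlen_double_add true) //.
  rewrite (@subSn (bitlen n) p) ?bitlen_leq // !subSS descendant_sumS.
  by rewrite [RHS]addrAC !addrK.
rewrite ifF; last by have := expn_gt0 2 p; lia.
(* A leaf has at least [p.+1] bits, so no level lies below it. *)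
suff -> : (p.+1 - bitlen n = 0)%N by rewrite descendant_sum0.
by have := bitlen_leq p n n0; lia.
Qed.

Variables (p : nat) (f : nat -> V).
Hypotheses (p_gt0 : (0 < p)%N) (fP : solves p g f).

Lemma solution_eq (n : nat) : (1 <= n <= 2 ^ p - 1)%N ->
  f n = descendant_sum (p - bitlen n) n.
Proof.
case: p p_gt0 fP => // q _ gE.
(* Induction on the distance to the leaves, which drops by one from [n] to its children. *)
move dE: (q.+1 - bitlen n)%N => d.
elim: d n dE => [|d IH] n dE nP; move: (gE n nP) => /=; case/andP: (nP) => n0 nle.
  rewrite ifF; first by rewrite descendant_sum0.
  by have := bitlen_leq q n n0; have := expn_gt0 2 q; lia.
have lt : (n < 2 ^ q)%N by rewrite -bitlen_leq //; lia.
rewrite ifT; last by lia.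
have b0 := bitlen_double_add false n n0; have b1 := bitlen_double_add true n n0.
rewrite /= addn0 in b0; rewrite /= in b1.
have lt2 : (2 * n + 1 <= 2 ^ q.+1 - 1)%N by rewrite expnS; lia.
rewrite descendant_sumS -!IH; try lia.
by move=> ->; rewrite addrAC subrK subrK.
Qed.

Lemma sum_s2_solution :
  \sum_(1 <= n < 2 ^ p) g n *+ s2 n =
    \sum_(0 <= n < 2 ^ p.-1) f (2 * n + 1)%N.
Proof.
have s20 : s2 0 = 0%N by rewrite /s2 /bitlen big_ord_recl big_ord0.
case: p p_gt0 fP => // q _ gE /=.
have q0 := expn_gt0 2 q.
have lt2 : (2 ^ q <= 2 ^ q.+1)%N by rewrite leq_exp2l.
(* Index 0 is added so that indices pair up as [2 * n] and [2 * n + 1]; the system says nothing of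
   [g 0], but its weight [s2 0] is zero. *)
transitivity (\sum_(0 <= n < 2 ^ q.+1) g n *+ s2 n).
  by rewrite [RHS]big_ltn ?expn_gt0 // s20 mulr0n add0r.
transitivity (\sum_(0 <= n < 2 ^ q.+1) f n *+ s2 n -
    \sum_(0 <= n < 2 ^ q) (f (2 * n)%N + f (2 * n + 1)%N) *+ s2 n).
  rewrite !(@big_cat_nat _ _ _ (2 ^ q)%N 0 (2 ^ q.+1)) //= addrAC -sumrB.
  congr (_ + _); apply: eq_big_nat => n /andP[n1 n2].
    case: n => [|n] in n1 n2 *; first by rewrite s20 !mulr0n subr0.
    rewrite gE /=; last by lia.
    by rewrite ifT; [rewrite -addrA -opprD mulrnBl | lia].
  by rewrite gE /=; [rewrite ifF //; lia | lia].
(* In each pair the weights are [s2 n] and [s2 n + 1]; subtracting [s2 n] from both leaves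
   [f (2 * n + 1)] once. *)
rewrite expnS sum_double -sumrB; apply: eq_bigr => n _.
rewrite (s2_double_add true) -{2}[(2 * n)%N]addn0 (s2_double_add false) addn0.
by rewrite mulrnDr mulrnDl addrA [LHS]addrC addKr.
Qed.

End ClosedForm.

Theorem theorem28 (R : realType) (p : nat) (hp : (1 <= p)%N)
    (g : nat -> R[i]) :
  (exists f : nat -> R[i], solves p g f /\
     forall f' : nat -> R[i], solves p g f' ->
       forall n : nat, (1 <= n <= 2 ^ p - 1)%N -> f' n = f n) /\
  (forall f : nat -> R[i], solves p g f ->
     forall n : nat, (1 <= n <= 2 ^ p - 1)%N ->
       f n = \sum_(0 <= k < (p - bitlen n).+1) \sum_(0 <= l < 2 ^ k)
               g (2 ^ k * n + l)%N) /\
  \sum_(1 <= n < 2 ^ p) (s2 n)%:R * g n =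
    \sum_(0 <= n < 2 ^ p.-1)
      \sum_(0 <= k < (p - bitlen (2 * n + 1)).+1)
        \sum_(0 <= l < 2 ^ k) g (2 ^ k.+1 * n + 2 ^ k + l)%N.
Proof.
have F := solves_descendant_sum _ g _ hp.
split; [|split].
- exists (fun n => descendant_sum _ g (p - bitlen n) n); split=> // f fP n.
  exact: solution_eq.
- move=> f fP n; exact: solution_eq.
under eq_bigr do rewrite mulr_natl.
(* This identity mentions no solution, so the explicit one is inserted; the indices agree since [2 ^
   k * (2 * n + 1) = 2 ^ k.+1 * n + 2 ^ k]. *)
rewrite (sum_s2_solution _ _ _ _ hp F); apply: eq_bigr => n _.
apply: eq_bigr => k _; apply: eq_bigr => l _; congr g.
by rewrite expnSr; lia.
Qed.
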